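(* Let $p$ be a prime with $p\equiv 1\pmod 4$. Then, in $\mathbb Z[i]$, $$\mathbf G_p(p)\equiv p^2(1+i)\pmod{p^3}.$$ Equivalently, $v_p(\mathbf G_p(p))=2$ and $\dfrac{\mathbf G_p(p)}{p^2}\equiv 1+i\pmod p$.
   Context: Here $i^2=-1$. For an odd prime $p$ and $n\ge 0$, $\mathbf G_n(p)=\sum_{a=1}^{p-1}\sum_{b=1}^{p-1}(a+bi)^n\in\mathbb Z[i]$; $\mathbf G_p(p)$ is the case $n=p$. For $x+yi\in\mathbb Z[i]$, $v_p(x+yi)=\min\{v_p(x),v_p(y)\}$, where $v_p$ on integers is the usual $p$-adic valuation. *)

(* Defs.v *)
From HB Require Import structures.
From mathcomp Require Import all_boot all_order all_algebra.
From mathcomp Require Import complex constructive_ereal.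

Set Implicit Arguments.
Unset Strict Implicit.
Unset Printing Implicit Defensive.

Import Order.TTheory GRing.Theory Num.Theory.
Local Open Scope ring_scope.

(* The library makes [complex R] a ring only for R a field; over int it is just
   a Zmodule.  The ring structure below uses the library's own product
   [ComplexField.mulc]. *)
Definition gaussInt : Type := complex int.

HB.instance Definition _ := GRing.Zmodule.on gaussInt.

Definition gaussInt_mul : gaussInt -> gaussInt -> gaussInt :=
  @ComplexField.mulc int.

Definition gaussInt_one : gaussInt := Complex 1 0.

Fact gaussInt_mul1 : left_id gaussInt_one gaussInt_mul.
Proof. by move=> [a b]; congr Complex; rewrite /= !mul1r !mul0r ?subr0 ?addr0. Qed.

Fact gaussInt_mulDl : left_distributive gaussInt_mul +%R.
Proof.
move=> [a b] [c d] [e f]; congr Complex; rewrite /= !mulrDl.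
  by rewrite opprD addrACA.
by rewrite addrACA.
Qed.

Fact gaussInt_one_neq0 : gaussInt_one != 0.
Proof. by []. Qed.

HB.instance Definition _ := GRing.Zmodule_isComNzRing.Build gaussInt
  (@ComplexField.mulcA int) (@ComplexField.mulcC int)
  gaussInt_mul1 gaussInt_mulDl gaussInt_one_neq0.

Definition gaussI : gaussInt := Complex 0 1.

Fact gaussI_sqr : gaussI ^+ 2 = -1.
Proof. by []. Qed.

Definition congr_mod (R : comPzRingType) (m x y : R) : Prop :=
  exists z : R, x - y = m * z.

Definition gaussG (n p : nat) : gaussInt :=
  \sum_(1 <= a < p) \sum_(1 <= b < p) (a%:R + b%:R * gaussI) ^+ n.

(* [\bar int] is int with infinities adjoined; [+oo] encodes v_p(0), since
   [logn p 0] is 0. *)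
Definition padic_val (p : nat) (x : int) : \bar int :=
  if x == 0 then +oo%E else ((logn p `|x|%N)%:Z)%:E.

Definition gauss_val (p : nat) (z : gaussInt) : \bar int :=
  Order.min (padic_val p (complex.Re z)) (padic_val p (complex.Im z)).

(* Main.v *)
Require Import Defs.
From mathcomp Require Import all_boot all_order all_algebra all_solvable.
From mathcomp Require Import complex constructive_ereal ring zify.

Import GRing.Theory.
Local Open Scope ring_scope.

(** Put P = p(1 + i). The reflection w |-> P - w permutes the box of all
    w = a + bi with 1 <= a, b < p, so that twice G_p(p) is the sum over the box
    of w^p + (P - w)^p. In the expansion of (P - w)^p the leading term - w^p
    cancels w^p because p is odd, the term linear in P is
    p P w^(p-1) = p^2 (1 + i) w^(p-1), and every further term vanishes modulo
    p^3: the quadratic one because p divides 'C(p, 2), the others because p^3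
    divides P^k for k >= 3 ([expr_reflection]). Hence, modulo p^3,

      2 G_p(p) = p^2 (1 + i) \sum_w w^(p-1),

    and only the value modulo p of the last sum matters. By the binomial
    theorem this sum is a combination of products S_(p-1-k) S_k of power sums
    S_k = 1^k + ... + (p-1)^k. Modulo p, S_k vanishes for 0 < k < p-1
    ([dvdn_power_sum]), while S_0 = p-1 and S_(p-1) are both -1, so only the
    two extreme terms survive and the sum is 1 + i^(p-1)
    ([box_expr_pred_prime]). Both steps work for any element j of a commutative
    ring in place of i, and are combined at that generality in
    [box_expr_prime].

    When p = 1 modulo 4, i^(p-1) = 1, so 2 G_p(p) = 2 p^2 (1 + i) modulo p^3,
    and 2 can be cancelled since p^3 is odd. The valuation is then read off
    from G_p(p) = p^2 (1 + i + p z): the coordinates of the second factor are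
    1 modulo p, hence prime to p. *)

(** * Congruences in a commutative ring *)

Section Congruence.
Context {R : comPzRingType}.
Implicit Types m x y z : R.

Lemma congr_mod_refl m x : congr_mod m x x.
Proof. by exists 0; rewrite subrr mulr0. Qed.

Lemma congr_mod_trans {m x y z} :
  congr_mod m x y -> congr_mod m y z -> congr_mod m x z.
Proof.
by case=> u eu [v ev]; exists (u + v); rewrite mulrDr -eu -ev addrA subrK.
Qed.

Lemma congr_modD {m x x' y y'} :
  congr_mod m x x' -> congr_mod m y y' -> congr_mod m (x + y) (x' + y').
Proof.
by case=> u eu [v ev]; exists (u + v); rewrite mulrDr -eu -ev opprD addrACA.
Qed.

Lemma congr_modM {m x x' y y'} :
  congr_mod m x x' -> congr_mod m y y' -> congr_mod m (x * y) (x' * y').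
Proof.
case=> u eu [v ev]; exists (u * y + x' * v).
by rewrite mulrDr mulrA -eu mulrCA -ev mulrBl mulrBr addrA subrK.
Qed.

Lemma congr_mod_scale a {m x y} :
  congr_mod m x y -> congr_mod (a * m) (a * x) (a * y).
Proof. by case=> z eq; exists z; rewrite -mulrBr eq mulrA. Qed.

Lemma congr_mod_mull m x : congr_mod m (m * x) 0.
Proof. by exists x; rewrite subr0. Qed.

Lemma congr_mod_sum {m} {I : Type} (r : seq I) {P : pred I} {F G : I -> R} :
  (forall i, P i -> congr_mod m (F i) (G i)) ->
  congr_mod m (\sum_(i <- r | P i) F i) (\sum_(i <- r | P i) G i).
Proof.
move=> FG; elim/big_rec2: _ => [|i x y Pi xy]; first exact: congr_mod_refl.
exact: congr_modD (FG i Pi) xy.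
Qed.

Lemma congr_mod_sum0 {m} {I : Type} (r : seq I) {P : pred I} {F : I -> R} :
  (forall i, P i -> congr_mod m (F i) 0) ->
  congr_mod m (\sum_(i <- r | P i) F i) 0.
Proof. by move=> F0; have := congr_mod_sum r F0; rewrite big1_eq. Qed.

Lemma congr_mod_nat {p a b : nat} :
  a = b %[mod p] -> congr_mod (p%:R : R) a%:R b%:R.
Proof.
move=> ab; exists ((a %/ p)%:R - (b %/ p)%:R).
rewrite {1}(divn_eq a p) {1}(divn_eq b p) ab !natrD !natrM mulrBr.
by rewrite opprD addrACA subrr addr0 !(mulrC p%:R).
Qed.

(** An odd n = 2h + 1 makes 2 invertible: if 2 d = n z, then
    d = n d - h (2 d) = n (d - h z). *)
Lemma congr_mod_cancel2 {n : nat} {x y} : odd n ->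
  congr_mod n%:R (2%:R * x) (2%:R * y) -> congr_mod n%:R x y.
Proof.
move=> n_odd [z]; rewrite -mulrBr => eq; exists (x - y - n./2%:R * z).
rewrite mulrBr mulrCA -eq mulrA -natrM -mulrBl -{1}(odd_double_half n) n_odd.
by rewrite add1n -muln2 -[_.+1%:R]natr1 [_ + 1]addrC addrK mul1r.
Qed.

End Congruence.

(** * Power sums modulo a prime *)

(** 'X^k - 1 has at most k < #|F| - 1 roots, so some nonzero c has c^k <> 1.
    Multiplication by c permutes F and multiplies the sum by c^k, which forces
    the sum to vanish. *)
Lemma sum_expf_eq0 (F : finFieldType) (k : nat) :
  (0 < k < #|F|.-1)%N -> \sum_(x : F) x ^+ k = 0.
Proof.
case/andP=> k_gt0 k_lt.
have [c c_neq0 ck] : exists2 c : F, c != 0 & c ^+ k != 1.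
  apply/exists_inP; apply: contraT.
  rewrite negb_exists_in => /forall_inP all1.
  have := @max_poly_roots F ('X^k - 1%:P) (enum (predC1 (0 : F))).
  rewrite size_XnsubC // -cardE cardC1 -size_poly_eq0 size_XnsubC // enum_uniq.
  have -> : all (root ('X^k - 1%:P)) (enum (predC1 (0 : F))).
    apply/allP => x; rewrite mem_enum => /all1; rewrite negbK => /eqP xk.
    by rewrite rootE !hornerE xk subrr.
  by move/(_ isT isT isT); rewrite ltnS leqNgt k_lt.
have /eqP : (1 - c ^+ k) * \sum_(x : F) x ^+ k = 0.
  rewrite mulrBl mul1r {1}(reindex_inj (mulfI c_neq0)) mulr_sumr.
  by apply/eqP; rewrite subr_eq0; apply/eqP/eq_bigr => x _; rewrite exprMn.
by rewrite mulf_eq0 subr_eq0 eq_sym (negPf ck) => /eqP.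
Qed.

Lemma dvdn_power_sum (p k : nat) : prime p -> (0 < k < p.-1)%N ->
  (p %| \sum_(1 <= a < p) a ^ k)%N.
Proof.
move=> p_pr k_bnd; have p_gt0 := prime_gt0 p_pr.
rewrite (dvdn_pcharf (pchar_Fp p_pr)) natr_sum.
have := @sum_expf_eq0 'F_p k; rewrite card_Fp // => /(_ k_bnd) sum0.
have k_gt0 : (0 < k)%N by case/andP: k_bnd.
apply/eqP; rewrite -[RHS]sum0.
transitivity (\sum_(x : 'F_p) ((x : nat)%:R : 'F_p) ^+ k).
  rewrite -(big_mkord xpredT (fun a => (a%:R : 'F_p) ^+ k)) Fp_cast //.
  rewrite (big_ltn p_gt0) expr0n eqn0Ngt k_gt0 add0r.
  by apply: eq_bigr => a _; rewrite natrX.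
by apply: eq_bigr => x _; rewrite natr_Zp.
Qed.

Lemma power_sum_pred_prime (p : nat) : prime p ->
  \sum_(1 <= a < p) a ^ p.-1 = p.-1 %[mod p].
Proof.
move=> p_pr; rewrite -modn_summ.
rewrite (eq_big_nat _ _ (F2 := fun=> 1%N)) ?sum_nat_const_nat ?muln1 ?subn1 //.
move=> a /andP[a_gt0 a_lt]; rewrite -(totient_prime p_pr).
rewrite Euler_exp_totient ?modn_small ?prime_gt1 //.
by rewrite coprime_sym prime_coprime // gtnNdvd.
Qed.

(** * Power sums over the box of all a + b j *)

Section Box.
Variables (R : comPzRingType) (p : nat).
Hypothesis p_pr : prime p.

Lemma box_exprE (j : R) (n : nat) :
  \sum_(1 <= a < p) \sum_(1 <= b < p) (a%:R + b%:R * j) ^+ n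
  = \sum_(k < n.+1) j ^+ k * ('C(n, k) *
      ((\sum_(1 <= a < p) a ^ (n - k)) * (\sum_(1 <= b < p) b ^ k)))%N%:R.
Proof.
under eq_bigr do under eq_bigr do rewrite exprDn.
under eq_bigr do rewrite exchange_big.
rewrite exchange_big; apply: eq_bigr => k _ /=.
rewrite !natrM !natr_sum mulrA mulr_suml mulr_sumr; apply: eq_bigr => a _.
rewrite !mulr_sumr; apply: eq_bigr => b _.
rewrite exprMn -mulr_natl !natrX; ring.
Qed.

(** Only the terms k = 0 and k = p - 1 of [box_exprE] survive modulo p; their
    integer coefficient is (p - 1) S_(p-1) = (-1) (-1) = 1. *)
Lemma box_expr_pred_prime (j : R) :
  congr_mod p%:R
    (\sum_(1 <= a < p) \sum_(1 <= b < p) (a%:R + b%:R * j) ^+ p.-1)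
    (1 + j ^+ p.-1).
Proof.
have p_gt1 := prime_gt1 p_pr.
have sum0 : (\sum_(1 <= a < p) a ^ 0 = p.-1)%N.
  by rewrite sum_nat_const_nat muln1 subn1.
have corner : (p.-1 * \sum_(1 <= a < p) a ^ p.-1 = 1 %[mod p])%N.
  rewrite -modnMmr power_sum_pred_prime // modnMmr.
  have -> : (p.-1 * p.-1 = p.-2 * p + 1)%N by nia.
  by rewrite modnMDl.
rewrite box_exprE; have [n def_n] : exists n, p.-1 = n.+1 by exists p.-2; lia.
rewrite def_n in sum0 corner *; rewrite big_ord_recl big_ord_recr /=.
rewrite subn0 bin0 /bump /= add1n subnn binn !mul1n sum0 expr0 mul1r.
rewrite [X in X%:R + _]mulnC.
apply: congr_modD; first exact: congr_mod_nat corner.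
rewrite -[X in congr_mod _ _ X]add0r; apply: congr_modD; last first.
  rewrite -[X in congr_mod _ _ X]mulr1; apply: congr_modM.
    exact: congr_mod_refl.
  exact: congr_mod_nat corner.
apply: congr_mod_sum0 => k _.
rewrite -(mulr0 (j ^+ bump 0 k)); apply: congr_modM; first exact: congr_mod_refl.
apply: (@congr_mod_nat _ _ _ 0);
apply/eqP; rewrite mod0n; do 2!apply: dvdn_mull.
by apply: dvdn_power_sum => //; rewrite def_n /bump; have := ltn_ord k; lia.
Qed.

Hypothesis p_odd : odd p.

(** Binomial expansion to first order in p t. The quadratic term is as small as
    the cubic ones because 'C(p, 2) contributes the missing factor p. *)
Lemma expr_reflection (t w : R) :
  congr_mod (p%:R ^+ 3) ((p%:R * t - w) ^+ p)
    (- w ^+ p + p%:R ^+ 2 * (t * w ^+ p.-1)).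
Proof.
have p_gt1 := prime_gt1 p_pr.
rewrite addrC exprDn.
rewrite -(big_mkord xpredT
  (fun i => (- w) ^+ (p - i) * (p%:R * t) ^+ i *+ 'C(p, i))).
rewrite big_ltn // big_ltn ?ltnS ?prime_gt0 //.
rewrite subn0 bin0 bin1 subn1 expr0 expr1 mulr1 mulr1n addrA.
rewrite -[X in congr_mod _ _ X]addr0; apply: congr_modD.
  have signE n : (- w) ^+ n = (-1) ^+ odd n * w ^+ n by rewrite [LHS]exprNn signr_odd.
  rewrite !signE p_odd.
  have -> : odd p.-1 = false by move: p_odd p_gt1; lia.
  rewrite expr1 expr0 mulN1r mul1r.
  rewrite (_ : (w ^+ _ * _) *+ p = p%:R ^+ 2 * (t * w ^+ p.-1)); first exact: congr_mod_refl.
  by rewrite -[LHS]mulr_natr; ring.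
rewrite big_nat; apply: congr_mod_sum0 => -[|[|[|k]]] //= k_lt.
  have /dvdnP[c ->] : (p %| 'C(p, 2))%N by apply: prime_dvd_bin => //; move: p_odd; lia.
  rewrite (_ : _ *+ _ = p%:R ^+ 3 * ((- w) ^+ (p - 2) * t ^+ 2 * c%:R)).
    exact: congr_mod_mull.
  by rewrite -[LHS]mulr_natr natrM; ring.
rewrite (_ : _ *+ _ =
  p%:R ^+ 3 * ((- w) ^+ (p - k.+3) * p%:R ^+ k * t ^+ k.+3 *+ 'C(p, k.+3))).
  exact: congr_mod_mull.
rewrite mulrnAr; congr (_ *+ _).
by rewrite (exprMn _ p%:R) -(addn3 k) (exprD p%:R); ring.
Qed.

(** Averaging over the reflection a + b j |-> p (1 + j) - (a + b j) of the box
    kills the p-th powers and leaves p^2 (1 + j) times a sum of (p-1)-th powers,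
    which is needed only modulo p. *)
Lemma box_expr_prime (j : R) :
  congr_mod (p%:R ^+ 3)
    (2%:R * \sum_(1 <= a < p) \sum_(1 <= b < p) (a%:R + b%:R * j) ^+ p)
    (p%:R ^+ 2 * ((1 + j) * (1 + j ^+ p.-1))).
Proof.
(* S is kept opaque, so that rewriting with reflS does not reach inside it. *)
have [S defS] : exists S, S =
  \sum_(1 <= a < p) \sum_(1 <= b < p) (a%:R + b%:R * j) ^+ p by eexists.
rewrite -defS [X in congr_mod _ X _]mulr_natl mulr2n.
have reflS : S = \sum_(1 <= a < p) \sum_(1 <= b < p)
    (p%:R * (1 + j) - (a%:R + b%:R * j)) ^+ p.
  rewrite defS big_nat_rev; apply: eq_big_nat => a /andP[_ a_lt].
  rewrite big_nat_rev; apply: eq_big_nat => b /andP[_ b_lt].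
  rewrite !add1n !subSS !natrB ?(ltnW a_lt) ?(ltnW b_lt) //; congr (_ ^+ _); ring.
have SS : congr_mod (p%:R ^+ 3) (S + S) (S + (- S + p%:R ^+ 2 * ((1 + j) *
    \sum_(1 <= a < p) \sum_(1 <= b < p) (a%:R + b%:R * j) ^+ p.-1))).
  apply: congr_modD; first exact: congr_mod_refl.
  rewrite {1}reflS defS !mulr_sumr -sumrN -big_split; apply: congr_mod_sum => a _ /=.
  rewrite !mulr_sumr -sumrN -big_split; apply: congr_mod_sum => b _ /=.
  exact: expr_reflection.
rewrite addrA subrr add0r in SS.
apply: congr_mod_trans SS _; rewrite exprSr; apply: congr_mod_scale.
by apply: congr_modM (congr_mod_refl _ _) (box_expr_pred_prime j).
Qed.

End Box.

(** * Valuation and conclusion *)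

Lemma padic_val_exp_mul_unit (p k : nat) (u : int) : prime p ->
  padic_val p (p%:Z ^+ k * (1 + p%:Z * u)) = k%:Z%:E.
Proof.
move=> p_pr; have p_gt1 := prime_gt1 p_pr.
have ndvd : ~~ (p %| `|(1 + p%:Z * u)%R|)%N.
  change (~~ (p%:Z %| 1 + p%:Z * u)%Z).
  by rewrite rpredDr ?dvdz_mulr // dvdzE dvdn1 gtn_eqF.
have unz : `|(1 + p%:Z * u)%R|%N != 0%N by apply: contraNneq ndvd => ->.
rewrite /padic_val mulf_eq0 expf_eq0 -[_ + _ == 0]absz_eq0 (negPf unz) orbF.
rewrite -[p%:Z == 0]absz_eq0 absz_nat (gtn_eqF (prime_gt0 p_pr)) andbF.
rewrite abszM abszX absz_nat lognM ?expn_gt0 ?(ltnW p_gt1) ?lt0n //.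
by rewrite (pfactorK k p_pr) lognE (negPf ndvd) !andbF addn0.
Qed.

Theorem theorem7 (p : nat) (p_prime : prime p) (p_mod4 : p = 1 %[mod 4]) :
  congr_mod (p%:R ^+ 3) (gaussG p p) (p%:R ^+ 2 * (1 + gaussI))
  /\ (gauss_val p (gaussG p p) = 2%:Z%:E
      /\ exists q : gaussInt,
           gaussG p p = p%:R ^+ 2 * q /\ congr_mod p%:R q (1 + gaussI)).
Proof.
have p_odd : odd p by move: p_mod4; lia.
have ip : gaussI ^+ p.-1 = 1.
  have -> : p.-1 = (4 * (p %/ 4))%N by move: p_mod4; lia.
  by rewrite exprM (_ : gaussI ^+ 4 = 1) // expr1n.
have G_congr : congr_mod (p%:R ^+ 3) (gaussG p p) (p%:R ^+ 2 * (1 + gaussI)).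
  rewrite -natrX; apply: congr_mod_cancel2; first by rewrite oddX p_odd orbT.
  have := box_expr_prime _ _ p_prime p_odd gaussI; rewrite ip natrX.
  by rewrite (_ : _ * (_ * _) = 2%:R * (p%:R ^+ 2 * (1 + gaussI))) //; ring.
split=> //; case: G_congr => z /eqP; rewrite subr_eq => /eqP G_eq.
have {}G_eq : gaussG p p = p%:R ^+ 2 * (1 + gaussI + p%:R * z).
  by rewrite G_eq; ring.
split; last first.
  by exists (1 + gaussI + p%:R * z); split=> //; exists z; rewrite addrC addKr.
have natE n : n%:R = Complex n%:Z 0 :> gaussInt.
  by elim: n => // n IHn; rewrite -natr1 IHn; congr Complex; rewrite /= ?addr0 //; lia.
have prodE (m n x y : int) :
    (Complex m 0 : gaussInt)
      * (1 + gaussI + (Complex n 0 : gaussInt) * (Complex x y : gaussInt))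
    = Complex (m * (1 + n * x)) (m * (1 + n * y)).
  by congr Complex; rewrite /=; ring.
case: z G_eq => x y; rewrite -natrX !natE prodE -[(p ^ 2)%N%:Z]natz natrX natz /gauss_val => ->.
by rewrite /= !padic_val_exp_mul_unit // minxx.
Qed.
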